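(* Let $\mathcal G$ be an MCS and $f=f_{\mu_L,\mu_H}$ a (possibly tagged) bi-multiset level mapping. Let $g=p(\bar x)\,:\!-\,\pi;\,q(\bar y)\in\mathcal G$ be such that every cycle $\mathcal C$ of the control-flow graph of $\mathcal G$ that includes $g$ satisfies: (1) all transition rules in $\mathcal C$ are oriented by $f$, and at least one of them strictly; (2) at least one transition rule in $\mathcal C$ is bounded w.r.t. $f$. Then $g$ is a $\Phi_f$-anchor for $\mathcal G$, where $\Phi_f(p(\bar x))=p_f^{high}(\bar x)-p_f^{low}(\bar x)$, taking values in multisets of integers quasi-ordered by $\succsim^{\mu_D}$ ($\mu_D$ the type of the difference) with well-founded subset $\mathcal D_+$ the well-founded subset of that type.
   Context: MCS: a finite set of transition rules over program points with fixed arities; a rule is $p(\bar x)\,:\!-\,\pi;\,q(\bar y)$ with $\bar x,\bar y$ tuples of distinct variables of the arities of $p,q$ and $\pi$ a conjunction of constraints $a>b$, $a\ge b$, $a,b\in\bar x\cup\bar y$, over $\mathbb Z$; $\pi\models R$ means $R$ holds under every integer assignment satisfying $\pi$. A state is $p(\bar x)$ with $\bar x$ integers. The control-flow graph has the program points as vertices and an arc $p\to q$ for each rule; a cycle of $\mathcal G$ is a cycle of this multigraph (a sequence of rules). A run is a sequence of states where each consecutive pair corresponds to a rule of $\mathcal G$ whose constraint is satisfied by the values. Orders on finite integer multisets: (max) $S\succsim^{max}T$ iff $\max S\ge\max T$ or $T=\emptyset$; $S\succ^{max}T$ iff $\max S>\max T$ or ($T=\emptyset\ne S$). (min) $S\succsim^{min}T$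 iff $\min S\ge\min T$ or $S=\emptyset$; $S\succ^{min}T$ iff $\min S>\min T$ or ($S=\emptyset\ne T$). (ms) $S\succ^{ms}T$ iff $T$ arises from $S$ by replacing a non-empty sub-multiset $U$ by some $V$ with $U\succ^{max}V$; $\succsim^{ms}$ is $\succ^{ms}$ or equality. (dms) $S\succ^{dms}T$ iff $T$ arises from $S$ by replacing a sub-multiset $U$ by a non-empty $V$ with $U\succ^{min}V$; $\succsim^{dms}$ is $\succ^{dms}$ or equality. Well-founded subsets: for $min$/$max$, multisets with non-negative minimum/maximum; for $ms$/$dms$, multisets with all elements non-negative. Multiset difference of non-empty $L,H$ of types $\mu_L,\mu_H$: if $\mu_L\in\{max,min\}$, $H-L=\{h-\mu_L(L):h\in H\}$ of type $\mu_H$; if $\mu_L\in\{ms,dms\}$, $\mu_H\in\{min,max\}$, $H-L=\{\mu_H(H)-\ell:\ell\in L\}$ of type $dms$ (if $\mu_L=ms$) or $ms$ (if $\mu_L=dms$); otherwise undefined ($\mu_L,\mu_H$ compatible iff defined). $H\sqsupseteq_+ L$ means $H-L$ lies in the well-founded subset of its type. Level mapping $f_{\mu_L,\mu_H}$ ($\mu_L,\mu_H$ compatible): assigns to each program point $p$ a low and a high selection of its argument positions (depending only on $p$), giving multisets $p_f^{low}(\bar x)$ (type $\mu_L$) and $p_f^{high}(\bar x)$ (type $\mu_H$) of the selected values; in a tagged level mapping each selected position $i$ has a tag $t\in\{0,\dots,M-1\}$, $M$ the sum of all arities, and contributes $Mx_i+t$. $f$ orients $g=p(\bar x)\,:\!-\,\pi;\,q(\bar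 y)$ if $\pi\models p_f^{high}(\bar x)\succsim^{\mu_H}q_f^{high}(\bar y)$ and $\pi\models q_f^{low}(\bar y)\succsim^{\mu_L}p_f^{low}(\bar x)$; strictly if moreover $\pi\models p_f^{high}(\bar x)\succ^{\mu_H}q_f^{high}(\bar y)$ or $\pi\models q_f^{low}(\bar y)\succ^{\mu_L}p_f^{low}(\bar x)$. $g$ is bounded w.r.t. $f$ if $\pi\models p_f^{high}(\bar x)\sqsupseteq_+ p_f^{low}(\bar x)$. Anchor: for $\Phi$ from states to a quasi-order $(\mathcal D,\succsim)$ with well-founded subset $\mathcal D_+$, $g$ is a $\Phi$-anchor for $\mathcal G$ if for every run $p_0(\bar x_0)\to\cdots\to p_k(\bar x_k)\to p_{k+1}(\bar x_{k+1})$ of $\mathcal G$ whose first and last steps both correspond to $g$, $\Phi(p_i(\bar x_i))\succsim\Phi(p_{i+1}(\bar x_{i+1}))$ for all $0\le i\le k$, at least one strictly, and $\Phi(p_i(\bar x_i))\in\mathcal D_+$ for some $0\le i\le k$. *)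

(* Defs.v *)
From HB Require Import structures.
From mathcomp Require Import all_boot all_order all_algebra.
From mathcomp Require Import finmap multiset.

Set Implicit Arguments.
Unset Strict Implicit.
Unset Printing Implicit Defensive.

Import Order.TTheory GRing.Theory Num.Theory.
Local Open Scope ring_scope.
Local Open Scope mset_scope.

Section MultisetOrders.
Implicit Types S T H L : {mset int}.

Definition mset_map (h : int -> int) S : {mset int} :=
  seq_mset [seq h x | x <- enum_mset S].

(* Only meaningful on non-empty multisets; the default value is 0. *)
Definition mset_max S : int :=
  \big[Num.max/head 0 (enum_mset S)]_(x <- enum_mset S) x.
Definition mset_min S : int :=
  \big[Num.min/head 0 (enum_mset S)]_(x <- enum_mset S) x.

Variant mset_type := Max | Min | Ms | Dms.

(* The comparisons of extrema are restricted to non-empty multisets, since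
   the maximum and the minimum of the empty multiset do not exist. *)
Definition ge_max S T : Prop :=
  [/\ S <> mset0, T <> mset0 & mset_max T <= mset_max S] \/ T = mset0.
Definition gt_max S T : Prop :=
  [/\ S <> mset0, T <> mset0 & mset_max T < mset_max S] \/
  (T = mset0 /\ S <> mset0).

Definition ge_min S T : Prop :=
  [/\ S <> mset0, T <> mset0 & mset_min T <= mset_min S] \/ S = mset0.
Definition gt_min S T : Prop :=
  [/\ S <> mset0, T <> mset0 & mset_min T < mset_min S] \/
  (S = mset0 /\ T <> mset0).

Definition gt_ms S T : Prop :=
  exists U V : {mset int},
    [/\ U <> mset0, U `<=` S, gt_max U V & T = (S `\` U) `+` V].
Definition ge_ms S T : Prop := gt_ms S T \/ S = T.

Definition gt_dms S T : Prop :=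
  exists U V : {mset int},
    [/\ V <> mset0, U `<=` S, gt_min U V & T = (S `\` U) `+` V].
Definition ge_dms S T : Prop := gt_dms S T \/ S = T.

Definition mset_ge (mu : mset_type) : {mset int} -> {mset int} -> Prop :=
  match mu with
  | Max => ge_max | Min => ge_min | Ms => ge_ms | Dms => ge_dms
  end.

Definition mset_gt (mu : mset_type) : {mset int} -> {mset int} -> Prop :=
  match mu with
  | Max => gt_max | Min => gt_min | Ms => gt_ms | Dms => gt_dms
  end.

(* The well-founded subset attached to each type. *)
Definition mset_wf (mu : mset_type) S : Prop :=
  match mu with
  | Max => S <> mset0 /\ 0 <= mset_max S
  | Min => S <> mset0 /\ 0 <= mset_min S
  | Ms | Dms => forall x, x \in S -> 0 <= x
  end.

(* The type of H - L for L of type muL and H of type muH; None when muL and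
   muH are incompatible. *)
Definition diff_type (muL muH : mset_type) : option mset_type :=
  match muL, muH with
  | (Max | Min), _ => Some muH
  | Ms, (Max | Min) => Some Dms
  | Dms, (Max | Min) => Some Ms
  | (Ms | Dms), (Ms | Dms) => None
  end.

(* The difference H - L; None when L or H is empty or when the types are
   incompatible. *)
Definition mset_diff (muL muH : mset_type) H L : option {mset int} :=
  if (H == mset0) || (L == mset0) then None else
  match muL, muH with
  | Max, _ => Some (mset_map (fun h => h - mset_max L) H)
  | Min, _ => Some (mset_map (fun h => h - mset_min L) H)
  | (Ms | Dms), Max => Some (mset_map (fun l => mset_max H - l) L)
  | (Ms | Dms), Min => Some (mset_map (fun l => mset_min H - l) L)
  | (Ms | Dms), (Ms | Dms) => None
  end.

(* The values of mset_diff as a quasi-ordered set: when the difference is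
   undefined, None is comparable to itself only and is not well-founded. *)
Definition diff_ge (mu : mset_type) (D E : option {mset int}) : Prop :=
  match D, E with
  | Some A, Some B => mset_ge mu A B
  | None, None => True
  | _, _ => False
  end.

Definition diff_gt (mu : mset_type) (D E : option {mset int}) : Prop :=
  match D, E with
  | Some A, Some B => mset_gt mu A B
  | _, _ => False
  end.

Definition diff_wf (mu : mset_type) (D : option {mset int}) : Prop :=
  if D is Some A then mset_wf mu A else False.

Definition sqsupseq_pos (muL muH : mset_type) H L : Prop :=
  if diff_type muL muH is Some mu then diff_wf mu (mset_diff muL muH H L)
  else False.

End MultisetOrders.

Section TransitionSystems.
Variables (P : finType) (arity : P -> nat).

(* The variables of a rule p(x) :- pi; q(y): the left summand is x, the right
   one is y. *)
Definition var (p q : P) : Type := ('I_(arity p) + 'I_(arity q))%type.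

(* (b, a, a') stands for a > a' if b holds and for a >= a' otherwise. *)
Definition constraint (p q : P) : Type := (bool * var p q * var p q)%type.

Record rule := Rule {
  src : P;
  tgt : P;
  guard : seq (constraint src tgt)
}.

Definition rule_code (r : rule) :
    {pq : P * P & seq (bool * ('I_(arity pq.1) + 'I_(arity pq.2))
                            * ('I_(arity pq.1) + 'I_(arity pq.2)))%type} :=
  existT _ (src r, tgt r) (guard r).

Definition rule_decode
    (c : {pq : P * P & seq (bool * ('I_(arity pq.1) + 'I_(arity pq.2))
                            * ('I_(arity pq.1) + 'I_(arity pq.2)))%type}) :
    rule :=
  Rule (projT2 c).

Lemma rule_codeK : cancel rule_code rule_decode.
Proof. by case. Qed.

HB.instance Definition _ := Countable.copy rule (can_type rule_codeK).

(* A finite set of rules, given as a list. *)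
Definition mcs : Type := seq rule.

Definition args (p : P) : Type := (arity p).-tuple int.

Definition state : Type := {p : P & args p}.

Definition var_val (p q : P) (x : args p) (y : args q) (v : var p q) : int :=
  match v with inl i => tnth x i | inr j => tnth y j end.

Definition sat_constraint (p q : P) (x : args p) (y : args q)
    (c : constraint p q) : Prop :=
  let: (b, v, w) := c in
  if b then var_val x y w < var_val x y v else var_val x y w <= var_val x y v.

Definition sat (p q : P) (x : args p) (y : args q) (pi : seq (constraint p q)) :
    Prop :=
  forall c, c \in pi -> sat_constraint x y c.

Definition entails (r : rule) (R : args (src r) -> args (tgt r) -> Prop) :
    Prop :=
  forall x y, sat x y (guard r) -> R x y.

Variant step (r : rule) : state -> state -> Prop :=
  Step (x : args (src r)) (y : args (tgt r)) of sat x y (guard r) :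
    step r (existT _ (src r) x) (existT _ (tgt r) y).

(* s 0 -> s 1 -> ... -> s n is a run; s is unconstrained beyond n. *)
Definition run (G : mcs) (n : nat) (s : nat -> state) : Prop :=
  forall i, (i < n)%N -> exists2 r, r \in G & step r (s i) (s i.+1).

(* Vertices and rules may be repeated along a cycle. *)
Definition cfg_cycle (G : mcs) (c : seq rule) : Prop :=
  [/\ c != [::], {subset c <= G} & cycle (fun r r' => tgt r == src r') c].

(* ge, gt and pos are the quasi-order, its strict part and the well-founded
   subset.  The condition 0 < k makes the first and the last step of the run
   two different steps. *)
Definition anchor (G : mcs) (D : Type) (ge gt : D -> D -> Prop)
    (pos : D -> Prop) (Phi : state -> D) (g : rule) : Prop :=
  forall (k : nat) (s : nat -> state),
    (0 < k)%N -> run G k.+1 s ->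
    step g (s 0%N) (s 1%N) -> step g (s k) (s k.+1) ->
    [/\ forall i, (i <= k)%N -> ge (Phi (s i)) (Phi (s i.+1)),
        exists2 i, (i <= k)%N & gt (Phi (s i)) (Phi (s i.+1)) &
        exists2 i, (i <= k)%N & pos (Phi (s i))].

Definition total_arity : nat := (\sum_(p : P) arity p)%N.

(* The tags of non-selected positions are irrelevant. *)
Definition tagging : Type := forall p : P, 'I_(arity p) -> 'I_total_arity.

Record level_mapping := LevelMapping {
  low_sel : forall p : P, {set 'I_(arity p)};
  high_sel : forall p : P, {set 'I_(arity p)};
  (* None if untagged; otherwise the tags of the low and of the high
     selection. *)
  tags : option (tagging * tagging)
}.

Definition contribution (t : option tagging) (p : P) (x : args p)
    (i : 'I_(arity p)) : int :=
  if t is Some tg then total_arity%:Z * tnth x i + (tg p i)%:Z else tnth x i.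

Definition selected (sel : forall p : P, {set 'I_(arity p)})
    (t : option tagging) (p : P) (x : args p) : {mset int} :=
  seq_mset [seq contribution t x i | i <- enum (sel p)].

Definition low (f : level_mapping) (p : P) (x : args p) : {mset int} :=
  selected (low_sel f) (omap fst (tags f)) x.

Definition high (f : level_mapping) (p : P) (x : args p) : {mset int} :=
  selected (high_sel f) (omap snd (tags f)) x.

Section Orientation.
Variables (muL muH : mset_type) (f : level_mapping).

Definition oriented (r : rule) : Prop :=
  entails (r := r) (fun x y => mset_ge muH (high f x) (high f y)) /\
  entails (r := r) (fun x y => mset_ge muL (low f y) (low f x)).

Definition strictly_oriented (r : rule) : Prop :=
  oriented r /\
  (entails (r := r) (fun x y => mset_gt muH (high f x) (high f y)) \/
   entails (r := r) (fun x y => mset_gt muL (low f y) (low f x))).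

Definition bounded (r : rule) : Prop :=
  entails (r := r) (fun x _ => sqsupseq_pos muL muH (high f x) (low f x)).

Definition state_diff (s : state) : option {mset int} :=
  mset_diff muL muH (high f (projT2 s)) (low f (projT2 s)).

End Orientation.

End TransitionSystems.

(* Main.v *)
(** The rules of the first k steps of a run whose steps 0 and k both use g form
    a cycle of the control-flow graph through g, so all steps are oriented, one
    of them strictly, and one is bounded.  Boundedness makes both multisets
    non-empty at one state, and since emptiness depends only on the program
    point and orientation propagates (non-)emptiness in a single direction, going
    round the cycle makes them non-empty everywhere.  On non-empty multisets
    every type of order is preserved by translations and reversed (exchanging
    ms with dms and max with min) by decreasing maps, and subtracting a strictly
    larger number from the smaller side yields a strict decrease.  As H - L is a
    translate of H by an extremum of L, or the opposite of a translate of L by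
    an extremum of H, the difference decreases as soon as H decreases or L
    increases. *)

Require Import Defs.
From mathcomp Require Import all_boot all_order all_algebra.
From mathcomp Require Import finmap multiset.

Set Implicit Arguments.
Unset Strict Implicit.
Unset Printing Implicit Defensive.

Import Order.TTheory GRing.Theory Num.Theory.
(* Restores [ge_max] and [ge_min], which [Order.TTheory] shadows. *)
Import Defs.

Section MultisetOrders.
Local Open Scope ring_scope.
Local Open Scope mset_scope.
Implicit Types (S T U V W H L : {mset int}) (h : int -> int).

(** * Images and extrema of multisets *)

Lemma seq_mset_cat (s t : seq int) :
  seq_mset (s ++ t) = seq_mset s `+` seq_mset t.
Proof. by apply/msetP => x; rewrite msetE2 !mset_seqE count_cat. Qed.

Lemma mset_mapP h S y :
  reflect (exists2 x, x \in S & y = h x) (y \in mset_map h S).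
Proof.
by rewrite in_mset mset_seqE -has_count has_pred1; apply: mapP.
Qed.

Lemma mset_mapD h S T : mset_map h (S `+` T) = mset_map h S `+` mset_map h T.
Proof.
rewrite /mset_map -seq_mset_cat -map_cat.
apply/eq_seq_msetP/perm_map.
by apply/eq_seq_msetP; rewrite seq_mset_cat !seq_mset_id.
Qed.

Lemma mset_map_comp h h' S :
  mset_map h (mset_map h' S) = mset_map (h \o h') S.
Proof.
apply/eq_seq_msetP; rewrite (map_comp h h'); apply: perm_map.
exact: perm_eq_seq_mset.
Qed.

Lemma eq_mset_map h h' S : h =1 h' -> mset_map h S = mset_map h' S.
Proof. by move=> e; rewrite /mset_map (eq_map e). Qed.

Lemma mset_neq0P S : reflect (exists x, x \in S) (S != mset0).
Proof.
apply: (iffP idP) => [S0|[x xS]].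
  by case: (mset_0Vmem S) S0 => [->|[x xS]]; rewrite ?eqxx //; exists x.
by apply/eqP => S0; rewrite S0 in_mset0 in xS.
Qed.

Lemma mset_map_neq0 h S : (mset_map h S != mset0) = (S != mset0).
Proof.
apply/mset_neq0P/mset_neq0P => [[_ /mset_mapP[x xS _]]|[x xS]]; first by exists x.
by exists (h x); apply/mset_mapP; exists x.
Qed.

Lemma mset_max_mem S : S != mset0 -> mset_max S \in S.
Proof.
case/mset_neq0P => z zS; have {zS}: z \in enum_mset S by [].
suff: z \in enum_mset S -> mset_max S \in enum_mset S by [].
rewrite /mset_max; case: (enum_mset S) => // a s _ /=; rewrite big_seq.
(* The default value of the iterated maximum is the head of the enumeration, hence itself an
   element. *)
elim/big_ind: _ => [|x y xs ys|//]; first exact: mem_head.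
by case: leP.
Qed.

Lemma mset_min_mem S : S != mset0 -> mset_min S \in S.
Proof.
case/mset_neq0P => z zS; have {zS}: z \in enum_mset S by [].
suff: z \in enum_mset S -> mset_min S \in enum_mset S by [].
rewrite /mset_min; case: (enum_mset S) => // a s _ /=; rewrite big_seq.
elim/big_ind: _ => [|x y xs ys|//]; first exact: mem_head.
by case: leP.
Qed.

Lemma le_mset_max S x : x \in S -> x <= mset_max S.
Proof. by move=> xS; apply: le_bigmax_seq. Qed.

Lemma ge_mset_min S x : x \in S -> mset_min S <= x.
Proof. by move=> xS; apply: ge_bigmin_seq. Qed.

(** * Elementwise descriptions of the orders, uniform in the empty cases *)

Lemma ge_maxP S T :
  ge_max S T <-> forall y, y \in T -> exists2 x, x \in S & y <= x.
Proof.
split=> [[[/eqP S0 _ TS] y yT|-> y]|ST]; last 1 first.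
- have [/eqP T0|T0] := boolP (T == mset0); first by right.
  have [x xS Tx] := ST _ (mset_max_mem T0).
  left; split; [|exact/eqP|exact: le_trans (le_mset_max xS)].
  by apply/eqP/mset_neq0P; exists x.
- exists (mset_max S); first exact: mset_max_mem.
  exact: le_trans (le_mset_max yT) TS.
- by rewrite in_mset0.
Qed.

Lemma gt_maxP S T :
  gt_max S T <->
  S != mset0 /\ forall y, y \in T -> exists2 x, x \in S & y < x.
Proof.
split=> [[[/eqP S0 _ TS]|[-> /eqP S0]]|[S0 ST]].
- split=> // y yT; exists (mset_max S); first exact: mset_max_mem.
  exact: le_lt_trans (le_mset_max yT) TS.
- by split=> // y; rewrite in_mset0.
- have [/eqP T0|T0] := boolP (T == mset0); first by right; split=> //; exact/eqP.
  have [x xS Tx] := ST _ (mset_max_mem T0).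
  by left; split; [exact/eqP|exact/eqP|exact: lt_le_trans (le_mset_max xS)].
Qed.

Lemma ge_minP S T :
  ge_min S T <-> forall x, x \in S -> exists2 y, y \in T & y <= x.
Proof.
split=> [[[_ /eqP T0 TS] x xS|-> x]|ST]; last 1 first.
- have [/eqP S0|S0] := boolP (S == mset0); first by right.
  have [y yT yS] := ST _ (mset_min_mem S0).
  left; split; [exact/eqP| |exact: le_trans (ge_mset_min yT) yS].
  by apply/eqP/mset_neq0P; exists y.
- exists (mset_min T); first exact: mset_min_mem.
  exact: le_trans TS (ge_mset_min xS).
- by rewrite in_mset0.
Qed.

Lemma gt_minP S T :
  gt_min S T <->
  T != mset0 /\ forall x, x \in S -> exists2 y, y \in T & y < x.
Proof.
split=> [[[_ /eqP T0 TS]|[-> /eqP T0]]|[T0 ST]].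
- split=> // x xS; exists (mset_min T); first exact: mset_min_mem.
  exact: lt_le_trans TS (ge_mset_min xS).
- by split=> // x; rewrite in_mset0.
- have [/eqP S0|S0] := boolP (S == mset0); first by right; split=> //; exact/eqP.
  have [y yT yS] := ST _ (mset_min_mem S0).
  by left; split; [exact/eqP|exact/eqP|exact: le_lt_trans (ge_mset_min yT) yS].
Qed.

(** Naming the untouched part [W] replaces multiset subtraction by sums, which images respect.
    Non-emptiness of [U] already follows from [gt_max U V]. *)
Lemma gt_msP S T :
  gt_ms S T <-> exists U V W, [/\ S = W `+` U, T = W `+` V & gt_max U V].
Proof.
split=> [[U [V [U0 US UV ->]]]|[U [V [W [-> -> UV]]]]].
  by exists U, V, (S `\` U); rewrite msetBDK.
have [/eqP U0 _] := (gt_maxP U V).1 UV.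
exists U, V; split=> //; last by rewrite msetDKBC.
by rewrite -{1}[U]mset0D msetSD // msub0set.
Qed.

Lemma gt_dmsP S T :
  gt_dms S T <-> exists U V W, [/\ S = W `+` U, T = W `+` V & gt_min U V].
Proof.
split=> [[U [V [U0 US UV ->]]]|[U [V [W [-> -> UV]]]]].
  by exists U, V, (S `\` U); rewrite msetBDK.
have [/eqP V0 _] := (gt_minP U V).1 UV.
exists U, V; split=> //; last by rewrite msetDKBC.
by rewrite -{1}[U]mset0D msetSD // msub0set.
Qed.

(** * Duality of the orders under decreasing maps *)

Definition dual_type mu :=
  match mu with Max => Min | Min => Max | Ms => Dms | Dms => Ms end.

Lemma gt_max_anti h S T : {mono h : x y /~ x < y} ->
  gt_max S T -> gt_min (mset_map h T) (mset_map h S).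
Proof.
move=> hP /gt_maxP[S0 ST]; apply/gt_minP; rewrite mset_map_neq0; split=> //.
move=> _ /mset_mapP[y /ST[x xS yx] ->]; exists (h x); last by rewrite hP.
by apply/mset_mapP; exists x.
Qed.

Lemma gt_min_anti h S T : {mono h : x y /~ x < y} ->
  gt_min S T -> gt_max (mset_map h T) (mset_map h S).
Proof.
move=> hP /gt_minP[S0 ST]; apply/gt_maxP; rewrite mset_map_neq0; split=> //.
move=> _ /mset_mapP[y /ST[x xS yx] ->]; exists (h x); last by rewrite hP.
by apply/mset_mapP; exists x.
Qed.

(** Images distribute over sums, so [Ms] and [Dms] reduce to [Max] and [Min] on the exchanged parts;
    reversal swaps the roles of these parts. *)
Lemma mset_gt_anti mu h S T : {mono h : x y /~ x < y} ->
  mset_gt mu S T -> mset_gt (dual_type mu) (mset_map h T) (mset_map h S).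
Proof.
move=> hP; case: mu => /=.
- exact: gt_max_anti.
- exact: gt_min_anti.
- move=> /gt_msP[U [V [W [-> -> UV]]]]; rewrite !mset_mapD; apply/gt_dmsP.
  by do 3 eexists; split=> //; apply: gt_max_anti UV.
- move=> /gt_dmsP[U [V [W [-> -> UV]]]]; rewrite !mset_mapD; apply/gt_msP.
  by do 3 eexists; split=> //; apply: gt_min_anti UV.
Qed.

Lemma mset_ge_anti mu h S T : {mono h : x y /~ x < y} ->
  mset_ge mu S T -> mset_ge (dual_type mu) (mset_map h T) (mset_map h S).
Proof.
move=> hP; have hP' : {mono h : x y /~ x <= y}.
  by move=> x y; rewrite !leNgt hP.
case: mu => /=.
- move=> /ge_maxP ST; apply/ge_minP => _ /mset_mapP[y /ST[x xS yx] ->].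
  by exists (h x); rewrite ?hP' //; apply/mset_mapP; exists x.
- move=> /ge_minP ST; apply/ge_maxP => _ /mset_mapP[y /ST[x xS yx] ->].
  by exists (h x); rewrite ?hP' //; apply/mset_mapP; exists x.
- by case=> [/(mset_gt_anti (mu := Ms) hP)|->]; [left|right].
- by case=> [/(mset_gt_anti (mu := Dms) hP)|->]; [left|right].
Qed.

(** * Implications between the orders *)

Lemma gt_max_ge S T : gt_max S T -> ge_max S T.
Proof.
move=> /gt_maxP[_ ST]; apply/ge_maxP => y /ST[x xS yx]; exists x => //.
exact: ltW.
Qed.

Lemma gt_min_ge S T : gt_min S T -> ge_min S T.
Proof.
move=> /gt_minP[_ ST]; apply/ge_minP => y /ST[x xS yx]; exists x => //.
exact: ltW.
Qed.

Lemma mset_gt_ge mu S T : mset_gt mu S T -> mset_ge mu S T.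
Proof. by case: mu; [exact: gt_max_ge|exact: gt_min_ge|left|left]. Qed.

(** An element of the common part dominates itself; an element of [V] is dominated by one of [U]. *)
Lemma ge_ms_max S T : ge_ms S T -> ge_max S T.
Proof.
case=> [/gt_msP[U [V [W [-> -> /gt_max_ge/ge_maxP UV]]]]|->]; apply/ge_maxP.
  move=> y; rewrite in_msetD => /orP[yW|/UV[x xU yx]].
    by exists y; rewrite ?in_msetD ?yW.
  by exists x; rewrite ?in_msetD ?xU ?orbT.
by move=> y yT; exists y.
Qed.

Lemma ge_dms_min S T : ge_dms S T -> ge_min S T.
Proof.
case=> [/gt_dmsP[U [V [W [-> -> /gt_min_ge/ge_minP UV]]]]|->]; apply/ge_minP.
  move=> y; rewrite in_msetD => /orP[yW|/UV[x xU yx]].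
    by exists y; rewrite ?in_msetD ?yW.
  by exists x; rewrite ?in_msetD ?xU ?orbT.
by move=> y yT; exists y.
Qed.

(** * Translations of multisets *)

Definition shift (c : int) S := mset_map (fun x => x - c) S.

Lemma opp_anti : {mono (fun x : int => - x) : x y /~ x < y}.
Proof. by move=> x y; rewrite ltrN2. Qed.

Lemma sub_anti (c : int) : {mono (fun x : int => c - x) : x y /~ x < y}.
Proof. by move=> x y; rewrite ltrD2l ltrN2. Qed.

(** A translation is a composite of two decreasing maps, so its monotonicity comes from applying
    duality twice. *)
Lemma shiftE c S : shift c S = mset_map -%R (mset_map (fun x => c - x) S).
Proof. by rewrite mset_map_comp; apply: eq_mset_map => x /=; rewrite opprB. Qed.

Lemma dual_typeK : involutive dual_type.
Proof. by case. Qed.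

Lemma mset_ge_shift mu c S T :
  mset_ge mu S T -> mset_ge mu (shift c S) (shift c T).
Proof.
move/(mset_ge_anti (sub_anti c))/(mset_ge_anti opp_anti).
by rewrite dual_typeK -!shiftE.
Qed.

Lemma mset_gt_shift mu c S T :
  mset_gt mu S T -> mset_gt mu (shift c S) (shift c T).
Proof.
move/(mset_gt_anti (sub_anti c))/(mset_gt_anti opp_anti).
by rewrite dual_typeK -!shiftE.
Qed.

(* Even for Ms and Dms the whole multiset may be replaced at once, since the
   extremum strictly decreases. *)
Lemma mset_gt_shift_lt mu (c d : int) S T : S != mset0 -> T != mset0 -> c < d ->
  mset_ge mu S T -> mset_gt mu (shift c S) (shift d T).
Proof.
move=> S0 T0 cd.
have max_shift : ge_max S T -> gt_max (shift c S) (shift d T).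
  move=> /ge_maxP ST; apply/gt_maxP; rewrite mset_map_neq0; split=> //.
  move=> _ /mset_mapP[y /ST[x xS yx] ->]; exists (x - c).
    by apply/mset_mapP; exists x.
  by rewrite ler_ltD // ltrN2.
have min_shift : ge_min S T -> gt_min (shift c S) (shift d T).
  move=> /ge_minP ST; apply/gt_minP; rewrite mset_map_neq0; split=> //.
  move=> _ /mset_mapP[y /ST[x xS yx] ->]; exists (x - d).
    by apply/mset_mapP; exists x.
  by rewrite ler_ltD // ltrN2.
case: mu => //= ST.
- apply/gt_msP; exists (shift c S), (shift d T), mset0.
  by rewrite !mset0D; split=> //; apply/max_shift/ge_ms_max.
- apply/gt_dmsP; exists (shift c S), (shift d T), mset0.
  by rewrite !mset0D; split=> //; apply/min_shift/ge_dms_min.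
Qed.

Lemma mset_ge_shift_le mu (c d : int) S T : S != mset0 -> T != mset0 -> c <= d ->
  mset_ge mu S T -> mset_ge mu (shift c S) (shift d T).
Proof.
move=> S0 T0; rewrite le_eqVlt => /orP[/eqP->|cd ST]; first exact: mset_ge_shift.
exact/mset_gt_ge/mset_gt_shift_lt.
Qed.

Lemma mset_gt_shift_le mu (c d : int) S T : S != mset0 -> T != mset0 -> c <= d ->
  mset_gt mu S T -> mset_gt mu (shift c S) (shift d T).
Proof.
move=> S0 T0; rewrite le_eqVlt => /orP[/eqP->|cd ST]; first exact: mset_gt_shift.
exact/mset_gt_shift_lt/mset_gt_ge.
Qed.

(* Meaningful for Max and Min only. *)
Definition extremum mu S := if mu is Max then mset_max S else mset_min S.

Definition is_extremal mu := if mu is (Max | Min) then true else false.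

Lemma extremum_le mu S T : is_extremal mu -> S != mset0 -> T != mset0 ->
  mset_ge mu S T -> extremum mu T <= extremum mu S.
Proof.
case: mu => //= _ /eqP S0 /eqP T0 [[]|] //.
Qed.

Lemma extremum_lt mu S T : is_extremal mu -> S != mset0 -> T != mset0 ->
  mset_gt mu S T -> extremum mu T < extremum mu S.
Proof.
by case: mu => //= _ /eqP S0 /eqP T0 [[]|[]].
Qed.

(** * Monotonicity of the multiset difference *)

Lemma mset_diff_low muL muH H L : is_extremal muL ->
  H != mset0 -> L != mset0 ->
  mset_diff muL muH H L = Some (shift (extremum muL L) H).
Proof. by rewrite /mset_diff => + /negPf-> /negPf->; case: muL. Qed.

Lemma mset_diff_high muL muH H L : ~~ is_extremal muL -> is_extremal muH ->
  H != mset0 -> L != mset0 ->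
  mset_diff muL muH H L = Some (mset_map -%R (shift (extremum muH H) L)).
Proof.
rewrite /mset_diff => + + /negPf-> /negPf->; rewrite mset_map_comp.
by case: muL; case: muH => //= _ _; congr Some; apply: eq_mset_map => x /=;
  rewrite opprB.
Qed.

(** Groups the compatible pairs by which side contributes only its extremum. In the second case [L]
    enters negated, whence the dual type. *)
Variant diff_type_spec muL muH : mset_type -> Prop :=
| LowExtremal of is_extremal muL : diff_type_spec muL muH muH
| HighExtremal of ~~ is_extremal muL & is_extremal muH :
    diff_type_spec muL muH (dual_type muL).

Lemma diff_typeP muL muH muD :
  diff_type muL muH = Some muD -> diff_type_spec muL muH muD.
Proof. by case: muL; case: muH => // -[<-]; constructor. Qed.

Section Difference.
Variables (muL muH muD : mset_type) (H L H' L' : {mset int}).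
Hypotheses (compat : diff_type muL muH = Some muD).
Hypotheses (H0 : H != mset0) (L0 : L != mset0).
Hypotheses (H'0 : H' != mset0) (L'0 : L' != mset0).
Hypotheses (HH' : mset_ge muH H H') (LL' : mset_ge muL L' L).

Lemma diff_ge_oriented :
  diff_ge muD (mset_diff muL muH H L) (mset_diff muL muH H' L').
Proof.
case: (diff_typeP compat) => [eL|eL eH].
  by rewrite !mset_diff_low //=; apply: mset_ge_shift_le => //; apply: extremum_le.
rewrite !mset_diff_high //=; apply: mset_ge_anti opp_anti _.
by apply: mset_ge_shift_le => //; apply: extremum_le.
Qed.

(** A strict change on the side reduced to its extremum makes the translations differ strictly; a
    strict change on the other side survives a weak change of translation. *)
Lemma diff_gt_oriented : mset_gt muH H H' \/ mset_gt muL L' L ->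
  diff_gt muD (mset_diff muL muH H L) (mset_diff muL muH H' L').
Proof.
case: (diff_typeP compat) => [eL|eL eH] gtHL.
  rewrite !mset_diff_low //=; case: gtHL => gtHL.
    by apply: mset_gt_shift_le => //; apply: extremum_le.
  by apply: mset_gt_shift_lt => //; apply: extremum_lt.
rewrite !mset_diff_high //=; apply: mset_gt_anti opp_anti _.
case: gtHL => gtHL.
  by apply: mset_gt_shift_lt => //; apply: extremum_lt.
by apply: mset_gt_shift_le => //; apply: extremum_le.
Qed.

End Difference.

Lemma diff_wf_neq0 muL muH mu H L :
  diff_wf mu (mset_diff muL muH H L) -> H != mset0 /\ L != mset0.
Proof.
by rewrite /mset_diff; case: (eqVneq H) => //=; case: (eqVneq L).
Qed.

(* For Max and Ms, S >= T forces S to be non-empty when T is; for Min and Dms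
   the implication goes the other way. *)
Definition nonempty_backward mu := if mu is (Max | Ms) then true else false.

Lemma mset_ge_neq0 mu S T : mset_ge mu S T ->
  if nonempty_backward mu then T != mset0 -> S != mset0
  else S != mset0 -> T != mset0.
Proof.
have max0 : ge_max S T -> T != mset0 -> S != mset0.
  move=> /ge_maxP ST /mset_neq0P[y /ST[x xS _]].
  by apply/mset_neq0P; exists x.
have min0 : ge_min S T -> S != mset0 -> T != mset0.
  move=> /ge_minP ST /mset_neq0P[y /ST[x xS _]].
  by apply/mset_neq0P; exists x.
by case: mu => //= [/ge_ms_max|/ge_dms_min].
Qed.

End MultisetOrders.

(** * Runs and propagation around cycles *)

Section Runs.
Variables (P : finType) (arity : P -> nat).
Implicit Types (f : level_mapping arity) (r g : rule arity) (s : state arity).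

Lemma selected_neq0 (sel : forall p : P, {set 'I_(arity p)}) t
    (p : P) (x : args arity p) :
  (selected sel t x != mset0) = (sel p != set0).
Proof.
apply/mset_neq0P/set0Pn => [[y]|[i ip]].
  rewrite in_mset mset_seqE -has_count has_pred1 => /mapP[i].
  by rewrite mem_enum => ip _; exists i.
exists (contribution t x i); rewrite in_mset mset_seqE -has_count has_pred1.
by apply: map_f; rewrite mem_enum.
Qed.

Lemma oriented_step muL muH f r s s' :
  oriented muL muH f r -> step r s s' ->
  mset_ge muH (high f (projT2 s)) (high f (projT2 s')) /\
  mset_ge muL (low f (projT2 s')) (low f (projT2 s)).
Proof. by case=> geH geL [x y xy]; split; [apply: geH|apply: geL]. Qed.

Lemma strictly_oriented_step muL muH f r s s' :
  strictly_oriented muL muH f r -> step r s s' ->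
  mset_gt muH (high f (projT2 s)) (high f (projT2 s')) \/
  mset_gt muL (low f (projT2 s')) (low f (projT2 s)).
Proof. by case=> _ [gtH|gtL] [x y xy]; [left; apply: gtH|right; apply: gtL]. Qed.

Lemma bounded_step muL muH muD f r s s' :
  diff_type muL muH = Some muD -> bounded muL muH f r -> step r s s' ->
  diff_wf muD (state_diff muL muH f s).
Proof.
move=> compat bd [x y xy]; have := bd x y xy.
by rewrite /sqsupseq_pos compat.
Qed.

Lemma step_src r s s' : step r s s' -> projT1 s = src r.
Proof. by case. Qed.

Lemma step_tgt r s s' : step r s s' -> projT1 s' = tgt r.
Proof. by case. Qed.

Lemma path_map_iota (T : Type) (e : rel T) (r : nat -> T) m n :
  (forall i, m <= i < m + n -> e (r i) (r i.+1)) ->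
  path e (r m) [seq r i | i <- iota m.+1 n].
Proof.
elim: n m => // n IHn m er /=; rewrite er ?leqnn ?addnS ?ltnS ?leq_addr //=.
by apply: IHn => i /andP[mi im]; apply: er; rewrite ltnW //= -addSnnS.
Qed.

(** From [i] go forward to [k.+1], jump back to 1, go forward to [k], jump back to 0, and go forward
    to [j]. *)
Lemma cycle_propagation (b : nat -> bool) k : 0 < k ->
  (forall i, i <= k -> b i -> b i.+1) -> b 0 = b k -> b 1 = b k.+1 ->
  forall i j, i <= k.+1 -> j <= k.+1 -> b i -> b j.
Proof.
move=> k0 bS b0 b1.
have mono n i : i + n <= k.+1 -> b i -> b (i + n).
  elim: n i => [|n IHn] i; first by rewrite addn0.
  rewrite -addSnnS => ik bi; apply: IHn => //; apply: bS => //.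
  by rewrite -ltnS (leq_trans _ ik) // leq_addr.
have le_mono i j : i <= j -> j <= k.+1 -> b i -> b j.
  by move=> ij jk; have := @mono (j - i) i; rewrite subnKC //; apply.
move=> i j ik jk bi; apply: (le_mono 0) => //; rewrite b0.
by apply: (le_mono 1) => //; rewrite b1; apply: le_mono bi.
Qed.

Lemma cycle_neq0 mu k (S : nat -> {mset int}%mset) : 0 < k ->
  (forall i, i <= k -> mset_ge mu (S i) (S i.+1)) \/
  (forall i, i <= k -> mset_ge mu (S i.+1) (S i)) ->
  (S 0 != mset0) = (S k != mset0) -> (S 1 != mset0) = (S k.+1 != mset0) ->
  forall i j, i <= k.+1 -> j <= k.+1 -> S i != mset0 -> S j != mset0.
Proof.
move=> k0 Sge S0k S1k i j ik jk.
suff [fwd|bwd] : (forall i, i <= k -> S i != mset0 -> S i.+1 != mset0) \/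
                 (forall i, i <= k -> S i.+1 != mset0 -> S i != mset0).
- exact: (@cycle_propagation (fun i => S i != mset0) k).
(* When non-emptiness travels backward, emptiness travels forward, so propagation applies to
   emptiness with [i] and [j] exchanged. *)
- apply: contra_neq => /eqP Sj0; apply/eqP.
  apply: (@cycle_propagation (fun i => S i == mset0) k) jk ik Sj0 => //.
  + by move=> n nk; apply: contraTT; apply: bwd.
  + exact: negb_inj.
  + exact: negb_inj.
(* The direction of travel depends on both the type of the order and the direction of the
   comparisons. *)
case: Sge => Sge; case E: (nonempty_backward mu); [right|left|left|right].
all: by move=> n nk; have := mset_ge_neq0 (Sge n nk); rewrite E.
Qed.

Lemma run_rules (G : mcs arity) g k (s : nat -> state arity) :
  run G k.+1 s -> g \in G -> step g (s 0) (s 1) -> step g (s k) (s k.+1) ->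
  exists r : nat -> rule arity,
    [/\ r 0 = g, r k = g &
        forall i, i <= k -> r i \in G /\ step (r i) (s i) (s i.+1)].
Proof.
move=> rs gG g0 gk.
have /fin_all_exists[r rP] (i : 'I_k.+1) :
    exists r, r \in G /\ step r (s i) (s i.+1).
  by have [r rG ri] := rs i (ltn_ord i); exists r.
(* Several rules may justify the same step, so the choice is overridden by [g] at both ends. *)
exists (fun i => if (i == 0) || (i == k) then g else r (inord i)).
rewrite !eqxx orbT; split=> // i ik.
case: eqP => [->|_] //; case: eqP => [->|_] //=.
by have := rP (inord i); rewrite inordK.
Qed.

End Runs.

Theorem theorem5 (P : finType) (arity : P -> nat) (G : mcs arity)
    (muL muH muD : mset_type) (compat : diff_type muL muH = Some muD)
    (f : level_mapping arity) (g : rule arity) (gG : g \in G)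
    (Hcycles : forall C : seq (rule arity),
       cfg_cycle G C -> g \in C ->
       ((forall r, r \in C -> oriented muL muH f r) /\
        (exists2 r, r \in C & strictly_oriented muL muH f r)) /\
       (exists2 r, r \in C & bounded muL muH f r)) :
  anchor G (diff_ge muD) (diff_gt muD) (diff_wf muD)
    (state_diff muL muH f) g.
Proof.
move=> k s k0 rs g0 gk.
have [r [r0 rk rP]] := run_rules rs gG g0 gk.
have rst i (ik : i <= k) := (rP i ik).2.
have memC i : i < k -> r i \in [seq r i | i <- iota 0 k].
  by move=> ik; apply: map_f; rewrite mem_iota.
have gC : g \in [seq r i | i <- iota 0 k] by rewrite -r0 memC.
(* The cycle stops at index [k - 1]: the rule at [k] is [g] again, already present at 0. *)
have cycC : cfg_cycle G [seq r i | i <- iota 0 k].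
  split; first by case: (k) k0.
    by move=> _ /mapP[i + ->]; rewrite mem_iota => /= /ltnW/rP[].
  have: path (fun r r' => tgt r == src r') (r 0) [seq r i | i <- iota 1 k].
    apply: path_map_iota => i ik.
    by rewrite -(step_tgt (rst i (ltnW ik))) (step_src (rst i.+1 ik)).
  (* The last vertex of the path is [r k = g = r 0], which closes the path into a cycle. *)
  case: (k) k0 rk => // k' _ rk.
  by rewrite -[X in iota 1 X]addn1 iotaD map_cat /= add1n rk -r0 cats1.
have [[oC [_ /mapP[i + ->] si]] [_ /mapP[j + ->] bj]] := Hcycles _ cycC gC.
rewrite !mem_iota /= !add0n => ik jk.
(* Index [k] lies outside the list of cycle indices, but its rule is [g]. *)
have {oC} o i' : i' <= k -> oriented muL muH f (r i').
  by rewrite leq_eqVlt => /orP[/eqP->|/memC/oC //]; rewrite rk; apply: oC.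
have {}bj := bounded_step compat bj (rst j (ltnW jk)).
have [Hj Lj] := diff_wf_neq0 bj.
have s0k : projT1 (s 0) = projT1 (s k) by rewrite (step_src g0) (step_src gk).
have s1k : projT1 (s 1) = projT1 (s k.+1).
  by rewrite (step_tgt g0) (step_tgt gk).
have jk1 : j <= k.+1 by rewrite ltnW // ltnW.
(* Non-emptiness spreads from the bounded state [j]; the two steps by [g] identify the program
   points at 0 and [k], and at 1 and [k.+1]. *)
have H0 i' : i' <= k.+1 -> high f (projT2 (s i')) != mset0.
  move=> i'k; apply: (@cycle_neq0 muH k (fun i => high f (projT2 (s i)))) jk1 _ _.
  - exact: k0.
  - by left=> n nk; have [] := oriented_step (o _ nk) (rst _ nk).
  - by rewrite /high !selected_neq0 s0k.
  - by rewrite /high !selected_neq0 s1k.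
  - exact: i'k.
  - exact: Hj.
have L0 i' : i' <= k.+1 -> low f (projT2 (s i')) != mset0.
  move=> i'k; apply: (@cycle_neq0 muL k (fun i => low f (projT2 (s i)))) jk1 _ _.
  - exact: k0.
  (* Low multisets grow along the run, so the comparisons are reversed here. *)
  - by right=> n nk; have [] := oriented_step (o _ nk) (rst _ nk).
  - by rewrite /low !selected_neq0 s0k.
  - by rewrite /low !selected_neq0 s1k.
  - exact: i'k.
  - exact: Lj.
split.
- move=> i' i'k; have [geH geL] := oriented_step (o _ i'k) (rst _ i'k).
  by apply: diff_ge_oriented => //; rewrite ?H0 ?L0 // ltnW.
- exists i; first exact: ltnW.
  have [geH geL] := oriented_step (o _ (ltnW ik)) (rst _ (ltnW ik)).
  have gtHL := strictly_oriented_step si (rst _ (ltnW ik)).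
  by apply: diff_gt_oriented => //; rewrite ?H0 ?L0 // ltnW // ltnW.
- by exists j; first exact: ltnW.
Qed.
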